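(* Let $\tau$ be the non-trivial automorphism of the number field $\mathbb{Q}(\sqrt5)$, applied to power series with coefficients in $\mathbb{Q}(\sqrt5)$ coefficientwise. Let $\mathfrak{V}_x,\mathfrak{W}_x,\mathfrak{V}^0_x,\mathfrak{W}^0_x$ be the functions defined in the context, identified with their Taylor series at the origin. Then $$\tau\,\mathfrak{V}_x(x,z,y)=\mathfrak{V}_x(x,y,z),\qquad \tau\,\mathfrak{W}_x(x,z,y)=-\mathfrak{W}_x(x,y,z),$$ and the same symmetry holds for the second pair: $$\tau\,\mathfrak{V}^0_x(x,z,y)=\mathfrak{V}^0_x(x,y,z),\qquad \tau\,\mathfrak{W}^0_x(x,z,y)=-\mathfrak{W}^0_x(x,y,z).$$ Here $\tau\,F(x,z,y)$ is obtained from the Taylor series of $F(x,y,z)$ by swapping $y$ and $z$, leaving $x$ intact, and applying $\tau$ to every coefficient.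
   Context: Let $\phi=\frac{1+\sqrt5}{2}$, so $\tau\phi=-\phi^{-1}$. The functions on $\mathbb{R}^3$ are $$\begin{aligned} \mathfrak{V}_x(x,y,z)={}&2x\sin\tfrac{x}{2}\sin\tfrac{\phi y}{2}\sin\tfrac{z}{2\phi}-2\phi x\sin\tfrac{x}{2\phi}\sin\tfrac{y}{2}\sin\tfrac{\phi z}{2}+2\phi^{-1}x\sin\tfrac{\phi x}{2}\sin\tfrac{y}{2\phi}\sin\tfrac{z}{2}\\ &+y\sin z+2y\cos\tfrac{x}{2}\cos\tfrac{\phi y}{2}\sin\tfrac{z}{2\phi}-2y\cos\tfrac{x}{2\phi}\cos\tfrac{y}{2}\sin\tfrac{\phi z}{2}\\ &+z\sin y-2z\cos\tfrac{x}{2}\sin\tfrac{\phi y}{2}\cos\tfrac{z}{2\phi}+2z\cos\tfrac{\phi x}{2}\sin\tfrac{y}{2\phi}\cos\tfrac{z}{2}, \end{aligned}$$ $$\begin{aligned} \mathfrak{W}_x(x,y,z)={}&x\cos y-x\cos z\\ &-\sqrt5\,x\cos\tfrac{x}{2}\cos\tfrac{\phi y}{2}\cos\tfrac{z}{2\phi}+\phi x\cos\tfrac{x}{2\phi}\cos\tfrac{y}{2}\cos\tfrac{\phi z}{2}+\phi^{-1}x\cos\tfrac{\phi x}{2}\cos\tfrac{y}{2\phi}\cos\tfrac{z}{2}\\ &-\phi^{-2}y\sin\tfrac{x}{2}\sin\tfrac{\phi y}{2}\cos\tfrac{z}{2\phi}-\phi^{2}y\sin\tfrac{x}{2\phi}\sin\tfrac{y}{2}\cos\tfrac{\phi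 z}{2}+\sqrt5\,y\sin\tfrac{\phi x}{2}\sin\tfrac{y}{2\phi}\cos\tfrac{z}{2}\\ &-\phi^{2}z\sin\tfrac{x}{2}\cos\tfrac{\phi y}{2}\sin\tfrac{z}{2\phi}-\phi^{-2}z\sin\tfrac{\phi x}{2}\cos\tfrac{y}{2\phi}\sin\tfrac{z}{2}+\sqrt5\,z\sin\tfrac{x}{2\phi}\cos\tfrac{y}{2}\sin\tfrac{\phi z}{2}, \end{aligned}$$ $$\begin{aligned} \mathfrak{V}^0_x(x,y,z)={}&2x\sin\tfrac{x}{2}\sin\tfrac{\phi y}{2}\sin\tfrac{z}{2\phi}-2\phi x\sin\tfrac{x}{2\phi}\sin\tfrac{y}{2}\sin\tfrac{\phi z}{2}+2\phi^{-1}x\sin\tfrac{\phi x}{2}\sin\tfrac{y}{2\phi}\sin\tfrac{z}{2}\\ &+2\phi y\sin z+(7-\sqrt5)y\cos\tfrac{x}{2}\cos\tfrac{\phi y}{2}\sin\tfrac{z}{2\phi}\\ &+2\phi^2y\cos\tfrac{x}{2\phi}\cos\tfrac{y}{2}\sin\tfrac{\phi z}{2}+2\sqrt5\,y\cos\tfrac{\phi x}{2}\cos\tfrac{y}{2\phi}\sin\tfrac{z}{2}\\ &-2\phi^{-1}z\sin y-(7+\sqrt5)z\cos\tfrac{x}{2}\sin\tfrac{\phi y}{2}\cos\tfrac{z}{2\phi}\\ &-2\phi^{-2}z\cos\tfrac{\phi x}{2}\sin\tfrac{y}{2\phi}\cos\tfrac{z}{2}-2\sqrt5\,z\cos\tfrac{x}{2\phi}\sin\tfrac{y}{2}\cos\tfrac{\phi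 z}{2}. \end{aligned}$$ With $\mathfrak{V}^0_y(x,y,z)=\mathfrak{V}^0_x(y,z,x)$ and $\mathfrak{V}^0_z(x,y,z)=\mathfrak{V}^0_x(z,x,y)$, the function $\mathfrak{W}^0_x=\frac{\partial\mathfrak{V}^0_z}{\partial y}-\frac{\partial\mathfrak{V}^0_y}{\partial z}$ is the first coordinate of $\mathfrak{W}^0=\nabla\times(\mathfrak{V}^0_x,\mathfrak{V}^0_y,\mathfrak{V}^0_z)$. All these Taylor series have coefficients in $\mathbb{Q}(\sqrt5)$. *)

(* Defs.v *)
From HB Require Import structures.
From mathcomp Require Import all_boot all_order all_algebra.
From mathcomp Require Import all_classical all_reals all_analysis.
From mathcomp Require Import ring lra.
Set Implicit Arguments.
Unset Strict Implicit.
Unset Printing Implicit Defensive.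
Import Order.TTheory GRing.Theory Num.Theory.
Local Open Scope ring_scope.

Section QuadraticField.
Variable R : realType.

(* Q(sqrt 5) as the subfield Q + Q sqrt 5 of R. *)
Definition in_Qsqrt5 : {pred R} :=
  fun x => `[< exists a b : rat, x = ratr a + ratr b * Num.sqrt 5 >].

Lemma in_Qsqrt5_divring : divring_closed in_Qsqrt5.
Proof.
have s5 : Num.sqrt 5 * Num.sqrt 5 = 5 :> R by rewrite -expr2 sqr_sqrtr.
split.
- by apply/asboolP; exists 1, 0; rewrite rmorph1 rmorph0 mul0r addr0.
- move=> _ _ /asboolP[a [b ->]] /asboolP[c [d ->]]; apply/asboolP.
  by exists (a - c), (b - d); rewrite !rmorphB /=; ring.
move=> x _ /asboolP[a [b ->]] /asboolP[c [d ->]]; apply/asboolP.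
have [->|nz] := eqVneq (ratr c + ratr d * Num.sqrt 5 : R) 0.
  by exists 0, 0; rewrite invr0 mulr0 rmorph0 mul0r addr0.
set n := c * c - 5 * (d * d).
have nE : ratr n = (ratr c + ratr d * Num.sqrt 5)
                   * (ratr c - ratr d * Num.sqrt 5) :> R.
  rewrite /n rmorphB !rmorphM /= ratr_nat.
  by ring: s5.
clearbody n.
have [n0|n0] := eqVneq (ratr n : R) 0.
  move/esym/eqP: nE; rewrite n0 mulf_eq0 (negPf nz) /= subr_eq0 => /eqP cE.
  have d0 : ratr d != 0 :> R.
    by apply: contraNneq nz => d0; rewrite cE d0 mul0r addr0.
  exists (a / (2 * c)), (b / (2 * c)).
  rewrite !fmorph_div !rmorphM /= ratr_nat -cE.
  have c0 : ratr c != 0 :> R.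
    by rewrite cE mulf_neq0 // gt_eqF // sqrtr_gt0.
  have cc0 : ratr c + ratr c != 0 :> R by rewrite -mulr2n mulrn_eq0 (negPf c0).
  have -> : ratr c + ratr c = 2 * ratr c :> R by ring.
  by field.
exists ((a * c - 5 * b * d) / n), ((b * c - a * d) / n).
rewrite !fmorph_div !rmorphB !rmorphM /= ratr_nat.
have m0 : ratr c - ratr d * Num.sqrt 5 != 0 :> R.
  by apply: contraNneq n0 => m0; rewrite nE m0 mulr0.
rewrite nE.
by field: s5; rewrite nz m0.
Qed.

HB.instance Definition _ :=
  GRing.isDivringClosed.Build R in_Qsqrt5 in_Qsqrt5_divring.

Record Qsqrt5 := MkQsqrt5 { Qsqrt5_val : R; _ : Qsqrt5_val \in in_Qsqrt5 }.

HB.instance Definition _ := [isSub for Qsqrt5_val].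
HB.instance Definition _ := [Choice of Qsqrt5 by <:].
HB.instance Definition _ := [SubChoice_isSubIntegralDomain of Qsqrt5 by <:].
HB.instance Definition _ := [SubIntegralDomain_isSubField of Qsqrt5 by <:].

End QuadraticField.

Section Taylor.
Variable R : realType.
Implicit Types (F : R -> R -> R -> R).

Definition partial_x F : R -> R -> R -> R :=
  fun x y z => derive1 (fun t => F t y z) x.
Definition partial_y F : R -> R -> R -> R :=
  fun x y z => derive1 (fun t => F x t z) y.
Definition partial_z F : R -> R -> R -> R :=
  fun x y z => derive1 (fun t => F x y t) z.

(* The coefficient of x^i y^j z^k in the Taylor series of F at the origin. *)
Definition taylor_coef F (i j k : nat) : R :=
  iter i partial_x (iter j partial_y (iter k partial_z F)) 0 0 0
  / (i`! * j`! * k`!)%:R.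

(* A power series in x, y, z over K: P i j k is the coefficient of
   x^i y^j z^k. *)
Definition power_series3 (K : Type) := nat -> nat -> nat -> K.

Definition is_taylor_series F (P : power_series3 (Qsqrt5 R)) : Prop :=
  forall i j k : nat, \val (P i j k) = taylor_coef F i j k.

End Taylor.

(* If P is the series of F(x, y, z), this is the series of sigma F(x, z, y). *)
Definition twist_swap (K : Type) (sigma : K -> K) (P : power_series3 K) :
    power_series3 K :=
  fun i j k => sigma (P i k j).

Section Functions.
Variable R : realType.

Local Notation sqrt5 := (Num.sqrt 5 : R).

Definition golden : R := (1 + sqrt5) / 2.

Local Notation phi := golden.

Definition Vx (x y z : R) : R :=
    2 * x * sin (x / 2) * sin (phi * y / 2) * sin (z / (2 * phi))
  - 2 * phi * x * sin (x / (2 * phi)) * sin (y / 2) * sin (phi * z / 2)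
  + 2 * phi^-1 * x * sin (phi * x / 2) * sin (y / (2 * phi)) * sin (z / 2)
  + y * sin z
  + 2 * y * cos (x / 2) * cos (phi * y / 2) * sin (z / (2 * phi))
  - 2 * y * cos (x / (2 * phi)) * cos (y / 2) * sin (phi * z / 2)
  + z * sin y
  - 2 * z * cos (x / 2) * sin (phi * y / 2) * cos (z / (2 * phi))
  + 2 * z * cos (phi * x / 2) * sin (y / (2 * phi)) * cos (z / 2).

Definition Wx (x y z : R) : R :=
    x * cos y - x * cos z
  - sqrt5 * x * cos (x / 2) * cos (phi * y / 2) * cos (z / (2 * phi))
  + phi * x * cos (x / (2 * phi)) * cos (y / 2) * cos (phi * z / 2)
  + phi^-1 * x * cos (phi * x / 2) * cos (y / (2 * phi)) * cos (z / 2)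
  - phi ^- 2 * y * sin (x / 2) * sin (phi * y / 2) * cos (z / (2 * phi))
  - phi ^+ 2 * y * sin (x / (2 * phi)) * sin (y / 2) * cos (phi * z / 2)
  + sqrt5 * y * sin (phi * x / 2) * sin (y / (2 * phi)) * cos (z / 2)
  - phi ^+ 2 * z * sin (x / 2) * cos (phi * y / 2) * sin (z / (2 * phi))
  - phi ^- 2 * z * sin (phi * x / 2) * cos (y / (2 * phi)) * sin (z / 2)
  + sqrt5 * z * sin (x / (2 * phi)) * cos (y / 2) * sin (phi * z / 2).

Definition V0x (x y z : R) : R :=
    2 * x * sin (x / 2) * sin (phi * y / 2) * sin (z / (2 * phi))
  - 2 * phi * x * sin (x / (2 * phi)) * sin (y / 2) * sin (phi * z / 2)
  + 2 * phi^-1 * x * sin (phi * x / 2) * sin (y / (2 * phi)) * sin (z / 2)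
  + 2 * phi * y * sin z
  + (7 - sqrt5) * y * cos (x / 2) * cos (phi * y / 2) * sin (z / (2 * phi))
  + 2 * phi ^+ 2 * y * cos (x / (2 * phi)) * cos (y / 2) * sin (phi * z / 2)
  + 2 * sqrt5 * y * cos (phi * x / 2) * cos (y / (2 * phi)) * sin (z / 2)
  - 2 * phi^-1 * z * sin y
  - (7 + sqrt5) * z * cos (x / 2) * sin (phi * y / 2) * cos (z / (2 * phi))
  - 2 * phi ^- 2 * z * cos (phi * x / 2) * sin (y / (2 * phi)) * cos (z / 2)
  - 2 * sqrt5 * z * cos (x / (2 * phi)) * sin (y / 2) * cos (phi * z / 2).

Definition V0y (x y z : R) : R := V0x y z x.
Definition V0z (x y z : R) : R := V0x z x y.

(* First coordinate of the curl of (V0x, V0y, V0z). *)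
Definition W0x (x y z : R) : R := partial_y V0z x y z - partial_z V0y x y z.

End Functions.

(* Main.v *)
Require Import Defs.
From mathcomp Require Import all_boot all_order all_algebra.
From mathcomp Require Import all_classical all_reals all_analysis.
From mathcomp Require Import ring.
Import Order.TTheory GRing.Theory Num.Theory.
Local Open Scope ring_scope.

(** Call F' a conjugate of F when the Taylor series of F' at the origin is
    obtained from that of F by applying tau to the coefficients.  Conjugation
    is compatible with sums, products, and the sine and cosine of functions
    that vanish at the origin, and it fixes the coordinates.  Hence a conjugate
    of an explicit trigonometric expression is found by applying tau to the
    constants written in it.  As tau is nontrivial, it sends sqrt 5 to
    - sqrt 5, so phi to - phi^-1: the frequencies phi / 2 and 1 / (2 phi) are
    exchanged up to sign.  Once the signs are pulled out by the parity of sin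
    and cos, the conjugate of Vx (x, y, z) reads Vx (x, z, y); likewise Wx gives
    - Wx (x, z, y), and V0x gives V0x (x, z, y) ([conj_Vx], [conj_Wx],
    [conj_V0x]).  For W0x no formula is expanded: by rotation of the variables,
    the conjugate of V0z (x, y, z) is V0y (x, z, y) and vice versa, so
    conjugation followed by the swap of y and z exchanges the two terms of the
    curl ([conj_W0x]).

    Conjugation is handled as the inductive relation [conj_fun] generated by
    these closure rules.  The product and chain rules show that it is stable
    under partial derivatives ([conj_partial]), and the values at the origin of
    two related functions are conjugate ([conj_at0]); together this compares all
    Taylor coefficients without a Leibniz formula ([conj_taylor_coef]).  The
    Taylor coefficients are iterated derivatives in a fixed order of the
    variables, so swapping y and z also requires that partial derivatives
    commute ([conj_partialC]). *)

(** * Partial derivatives of functions of three variables *)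

Variant axis := X | Y | Z.

Section Partials.
Set Implicit Arguments.
Unset Strict Implicit.
Variable R : realType.
Implicit Types (F G : R -> R -> R -> R) (x y z : R).

Definition coord (v : axis) x y z : R :=
  match v with X => x | Y => y | Z => z end.

Definition slice (v : axis) F x y z : R -> R :=
  match v with
  | X => fun t => F t y z | Y => fun t => F x t z | Z => fun t => F x y t
  end.

Definition partial (v : axis) : (R -> R -> R -> R) -> R -> R -> R -> R :=
  match v with
  | X => @partial_x R | Y => @partial_y R | Z => @partial_z R
  end.

Definition has_partial (v : axis) F G : Prop :=
  forall x y z, is_derive (coord v x y z) 1 (slice v F x y z) (G x y z).

Lemma funext3 F G : (forall x y z, F x y z = G x y z) -> F = G.
Proof.
by move=> FG; apply/funext => x; apply/funext => y; apply/funext => z.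
Qed.

Lemma has_partialE v F G : has_partial v F G -> partial v F = G.
Proof.
move=> FG; apply: funext3 => x y z; rewrite -(derive_val (is_derive := FG x y z)).
by case: v {FG} => /=; rewrite -derive1E.
Qed.

Lemma has_partial_cst v c : has_partial v (fun _ _ _ => c) (fun _ _ _ => 0).
Proof. by case: v => x y z /=; exact: is_derive_cst. Qed.

Lemma has_partial_id v : has_partial v (coord v) (fun _ _ _ => 1).
Proof. by case: v => x y z /=; exact: is_derive_id. Qed.

Lemma has_partial_coord v w :
  exists c : bool, has_partial v (coord w) (fun _ _ _ => c%:R).
Proof.
case: v; case: w; by
  [ exists true; exact: has_partial_id
  | exists false => x y z; exact: is_derive_cst].
Qed.

Lemma has_partialD v F F' G G' : has_partial v F F' -> has_partial v G G' ->
  has_partial v (fun x y z => F x y z + G x y z)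
                (fun x y z => F' x y z + G' x y z).
Proof.
move=> dF dG x y z; move: (is_deriveD (dF x y z) (dG x y z)).
by case: v dF dG.
Qed.

Lemma has_partialM v F F' G G' : has_partial v F F' -> has_partial v G G' ->
  has_partial v (fun x y z => F x y z * G x y z)
                (fun x y z => F' x y z * G x y z + F x y z * G' x y z).
Proof.
move=> dF dG x y z.
have -> : F' x y z * G x y z + F x y z * G' x y z =
          F x y z *: (G' x y z : R) + G x y z *: (F' x y z : R).
  by rewrite /GRing.scale/=; ring.
by move: (is_deriveM (dF x y z) (dG x y z)); case: v dF dG.
Qed.

Lemma has_partial_comp v F F' (f f' : R -> R) :
    (forall t : R, is_derive t (1 : R) f (f' t)) -> has_partial v F F' ->
  has_partial v (fun x y z => f (F x y z))
                (fun x y z => f' (F x y z) * F' x y z).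
Proof.
move=> df dF x y z.
by move: dF => /(_ x y z) dF; case: v dF => dF;
  exact: (is_derive1_comp (df _) dF).
Qed.

End Partials.

(** * Conjugate scalars and conjugate functions *)

Section GaloisConjugation.
Set Implicit Arguments.
Unset Strict Implicit.
Variables (R : realType) (tau : {rmorphism Qsqrt5 R -> Qsqrt5 R}).
Implicit Types (F G : R -> R -> R -> R) (a b : R) (u : Qsqrt5 R) (v w : axis).

Definition conj_scalar a b : Prop := exists2 u, a = \val u & b = \val (tau u).

Lemma conj_scalar_nat n : conj_scalar n%:R n%:R.
Proof. by exists n%:R; rewrite !rmorph_nat. Qed.

Lemma conj_scalarD a b a' b' :
  conj_scalar a a' -> conj_scalar b b' -> conj_scalar (a + b) (a' + b').
Proof. by move=> [u -> ->] [w -> ->]; exists (u + w); rewrite !rmorphD. Qed.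

Lemma conj_scalarN a a' : conj_scalar a a' -> conj_scalar (- a) (- a').
Proof. by move=> [u -> ->]; exists (- u); rewrite !rmorphN. Qed.

Lemma conj_scalarM a b a' b' :
  conj_scalar a a' -> conj_scalar b b' -> conj_scalar (a * b) (a' * b').
Proof. by move=> [u -> ->] [w -> ->]; exists (u * w); rewrite !rmorphM. Qed.

Lemma conj_scalarX n a a' :
  conj_scalar a a' -> conj_scalar (a ^+ n) (a' ^+ n).
Proof. by move=> [u -> ->]; exists (u ^+ n); rewrite !rmorphXn. Qed.

Lemma conj_scalarV a a' : conj_scalar a a' -> conj_scalar a^-1 a'^-1.
Proof. by move=> [u -> ->]; exists u^-1; rewrite !fmorphV. Qed.

Lemma conj_scalar_inj a b b' : conj_scalar a b -> conj_scalar a b' -> b = b'.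
Proof. by move=> [u -> ->] [w /val_inj -> ->]. Qed.

(** The arguments of sin and cos vanish at the origin because sin and cos take
    values in Q(sqrt 5) there.  The relation is an inductive span of explicit functions, so
    that facts about their derivatives follow by induction. *)
Inductive conj_fun : (R -> R -> R -> R) -> (R -> R -> R -> R) -> Prop :=
| conj_cst a a' : conj_scalar a a' ->
    conj_fun (fun _ _ _ => a) (fun _ _ _ => a')
| conj_coord v : conj_fun (@coord R v) (@coord R v)
| conjD F F' G G' : conj_fun F F' -> conj_fun G G' ->
    conj_fun (fun x y z => F x y z + G x y z)
             (fun x y z => F' x y z + G' x y z)
| conjM F F' G G' : conj_fun F F' -> conj_fun G G' ->
    conj_fun (fun x y z => F x y z * G x y z)
             (fun x y z => F' x y z * G' x y z)
| conj_sin F F' : conj_fun F F' -> F 0 0 0 = 0 -> F' 0 0 0 = 0 ->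
    conj_fun (fun x y z => sin (F x y z)) (fun x y z => sin (F' x y z))
| conj_cos F F' : conj_fun F F' -> F 0 0 0 = 0 -> F' 0 0 0 = 0 ->
    conj_fun (fun x y z => cos (F x y z)) (fun x y z => cos (F' x y z)).

(** Negation is multiplication by the rational scalar -1, which tau fixes. *)
Lemma conjN F F' : conj_fun F F' ->
  conj_fun (fun x y z => - F x y z) (fun x y z => - F' x y z).
Proof.
move=> FF'; have N1 : conj_fun (fun _ _ _ => -1) (fun _ _ _ => -1).
  by apply/conj_cst/conj_scalarN/(conj_scalar_nat 1).
by have := conjM N1 FF'; congr conj_fun; apply: funext3 => x y z;
  rewrite mulN1r.
Qed.

Lemma conj_at0 F F' : conj_fun F F' -> conj_scalar (F 0 0 0) (F' 0 0 0).
Proof.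
elim=> {F F'} //.
- by case; exact: (conj_scalar_nat 0).
- by move=> F F' G G' _ ? _ ?; exact: conj_scalarD.
- by move=> F F' G G' _ ? _ ?; exact: conj_scalarM.
- by move=> F F' _ _ -> ->; rewrite sin0; exact: (conj_scalar_nat 0).
- by move=> F F' _ _ -> ->; rewrite cos0; exact: (conj_scalar_nat 1).
Qed.

(** The product and chain rules express the derivative of a compound function
    by functions that the closure rules already cover; the sine rule calls on
    the cosine of the same argument, and conversely. *)
Lemma conj_has_partial v F F' : conj_fun F F' -> exists G G',
  [/\ has_partial v F G, has_partial v F' G' & conj_fun G G'].
Proof.
elim=> {F F'}.
- move=> a a' _; exists (fun _ _ _ => 0), (fun _ _ _ => 0).
  split; [exact: has_partial_cst.. | exact/conj_cst/(conj_scalar_nat 0)].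
- move=> w; have [c dw] := has_partial_coord R v w.
  exists (fun _ _ _ => c%:R), (fun _ _ _ => c%:R).
  by split => //; exact/conj_cst/conj_scalar_nat.
- move=> F F' G G' _ [dF [dF' [FdF FdF' dFdF']]] _ [dG [dG' [GdG GdG' dGdG']]].
  do 2 eexists; split; [exact: has_partialD FdF GdG
    | exact: has_partialD FdF' GdG' | exact: conjD].
- move=> F F' G G' FF' [dF [dF' [FdF FdF' dFdF']]].
  move=> GG' [dG [dG' [GdG GdG' dGdG']]].
  do 2 eexists; split; [exact: has_partialM FdF GdG
    | exact: has_partialM FdF' GdG' | by apply: conjD; exact: conjM].
- move=> F F' FF' [dF [dF' [FdF FdF' dFdF']]] F0 F'0.
  do 2 eexists; split; [exact: has_partial_comp FdF
    | exact: has_partial_comp FdF' | by apply: conjM => //; exact: conj_cos].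
- move=> F F' FF' [dF [dF' [FdF FdF' dFdF']]] F0 F'0.
  do 2 eexists; split; [exact: has_partial_comp FdF
    | exact: has_partial_comp FdF'
    | by apply: conjM => //; apply: conjN; exact: conj_sin].
Qed.

Lemma conj_partial v F F' : conj_fun F F' ->
  conj_fun (partial v F) (partial v F').
Proof.
by move=> /(conj_has_partial v)[G [G' [/has_partialE -> /has_partialE ->]]].
Qed.

Lemma conj_partialP v F F' : conj_fun F F' -> has_partial v F (partial v F).
Proof.
by move=> /(conj_has_partial v)[G [G' [FG _ _]]]; rewrite (has_partialE FG).
Qed.

Lemma conj_iter_partial v n F F' : conj_fun F F' ->
  conj_fun (iter n (partial v) F) (iter n (partial v) F').
Proof. by move=> FF'; elim: n => //= n; exact: conj_partial. Qed.

(** Clairaut's theorem for the functions of [conj_fun]: both sides are computed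
    from the derivatives of the constituents, and agree by the induction
    hypothesis for the mixed derivatives of those. *)
Lemma conj_partialC v w F F' : conj_fun F F' ->
  partial v (partial w F) = partial w (partial v F).
Proof.
elim=> {F F'}.
- by move=> a a' _; rewrite !(has_partialE (has_partial_cst _ _)).
- move=> s; have [c /has_partialE ->] := has_partial_coord R v s.
  have [d /has_partialE ->] := has_partial_coord R w s.
  by rewrite !(has_partialE (has_partial_cst _ _)).
- move=> F F' G G' FF' IHF GG' IHG.
  have dF s := conj_partialP s FF'; have dG s := conj_partialP s GG'.
  have ddF s t := conj_partialP s (conj_partial t FF').
  have ddG s t := conj_partialP s (conj_partial t GG').
  rewrite !(has_partialE (has_partialD (dF _) (dG _))).
  by rewrite !(has_partialE (has_partialD (ddF _ _) (ddG _ _))) IHF IHG.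
- move=> F F' G G' FF' IHF GG' IHG.
  have dF s := conj_partialP s FF'; have dG s := conj_partialP s GG'.
  have ddF s t := conj_partialP s (conj_partial t FF').
  have ddG s t := conj_partialP s (conj_partial t GG').
  rewrite !(has_partialE (has_partialM (dF _) (dG _))).
  rewrite !(has_partialE (has_partialD (has_partialM (ddF _ _) (dG _))
    (has_partialM (dF _) (ddG _ _)))) IHF IHG.
  by apply: funext3 => x y z; ring.
- move=> F F' FF' IHF _ _.
  have dF s := conj_partialP s FF'.
  have ddF s t := conj_partialP s (conj_partial t FF').
  rewrite !(has_partialE (has_partial_comp (@is_derive_sin R) (dF _))).
  rewrite !(has_partialE (has_partialM
    (has_partial_comp (@is_derive_cos R) (dF _)) (ddF _ _))) IHF.
  by apply: funext3 => x y z; ring.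
- move=> F F' FF' IHF F0 F'0.
  have dF s := conj_partialP s FF'.
  have ddF s t := conj_partialP s (conj_partial t FF').
  rewrite !(has_partialE (has_partial_comp (@is_derive_cos R) (dF _))).
  have dNsin (t : R) : is_derive t (1 : R) (fun s => - sin s) (- cos t).
    exact: is_deriveN.
  rewrite !(has_partialE (has_partialM
    (has_partial_comp dNsin (dF _)) (ddF _ _))) IHF.
  by apply: funext3 => x y z; ring.
Qed.

Lemma conj_iter_partialC v w m n F F' : conj_fun F F' ->
  iter m (partial v) (iter n (partial w) F) =
  iter n (partial w) (iter m (partial v) F).
Proof.
move=> FF'; elim: m => //= m ->.
have {FF'} := conj_iter_partial v m FF'.
set G := iter m _ F; set G' := iter m _ F'; move: G G' => G G' GG'.
elim: n => //= n <-.
exact: conj_partialC (conj_iter_partial w n GG').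
Qed.

(** The rules of [conj_fun] do not depend on the names of the variables. *)
Lemma conj_rot F F' : conj_fun F F' ->
  conj_fun (fun x y z => F z x y) (fun x y z => F' z x y).
Proof.
elim=> {F F'}; try by [constructor].
by case; [exact: (conj_coord Z)|exact: (conj_coord X)|exact: (conj_coord Y)].
Qed.

(** * Taylor coefficients *)

Lemma iter_partialZ v n (c : R) F F' : conj_fun F F' ->
  iter n (partial v) (fun x y z => c * F x y z) =
  fun x y z => c * iter n (partial v) F x y z.
Proof.
move=> FF'; elim: n => //= n ->.
have dF := conj_partialP v (conj_iter_partial v n FF').
rewrite (has_partialE (has_partialM (has_partial_cst v c) dF)).
by apply: funext3 => x y z; rewrite mul0r add0r.
Qed.

Lemma conj_taylor_coef i j k F F' : conj_fun F F' ->
  conj_scalar (taylor_coef F i j k) (taylor_coef F' i j k).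
Proof.
move=> FF'; apply: conj_scalarM; last exact/conj_scalarV/conj_scalar_nat.
exact: conj_at0 (conj_iter_partial X i (conj_iter_partial Y j
  (conj_iter_partial Z k FF'))).
Qed.

Lemma taylor_coef_swap i j k (c : R) F F' : conj_fun F F' ->
  taylor_coef (fun x y z => c * F x z y) i j k = c * taylor_coef F i k j.
Proof.
move=> FF'.
have swapX n G : iter n (partial X) (fun x y z => G x z y) =
                 fun x y z => iter n (partial X) G x z y by elim: n => //= n ->.
have swapY n G : iter n (partial Y) (fun x y z => G x z y) =
                 fun x y z => iter n (partial Z) G x z y by elim: n => //= n ->.
have swapZ n G : iter n (partial Z) (fun x y z => G x z y) =
                 fun x y z => iter n (partial Y) G x z y by elim: n => //= n ->.
pose cF := fun x y z => c * F x y z.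
have derivE : iter i (partial X) (iter j (partial Y) (iter k (partial Z)
    (fun x y z => cF x z y))) 0 0 0 =
    c * iter i (partial X) (iter k (partial Y) (iter j (partial Z) F)) 0 0 0.
  (* Swapping y and z turns the order x, y, z of differentiation into x, z, y;
     the last step below restores it. *)
  rewrite swapZ swapY swapX.
  rewrite (iter_partialZ Y k c FF').
  rewrite (iter_partialZ Z j c (conj_iter_partial Y k FF')).
  rewrite (iter_partialZ X i c (conj_iter_partial Z j
    (conj_iter_partial Y k FF'))).
  by rewrite -(conj_iter_partialC Y Z k j FF').
rewrite /taylor_coef; have -> := derivE.
by rewrite mulrA -mulnA (mulnC j`!) mulnA.
Qed.

(** A conjugate of F that equals c F (x, z, y) has two descriptions of its
    Taylor coefficients: as images under tau of those of F, and as c times the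
    coefficients of F with the last two indices swapped.  Applied with c = 1 and
    c = -1. *)
Lemma conj_twist_swap (c : R) F : conj_fun F (fun x y z => c * F x z y) ->
  exists2 P, is_taylor_series F P &
    forall i j k, \val (twist_swap tau P i j k) = c * \val (P i j k).
Proof.
move=> FF'.
(* The coefficients lie in Q(sqrt 5), so insubd returns them unchanged. *)
pose P i j k : Qsqrt5 R := insubd 0 (taylor_coef F i j k).
have PE i j k : \val (P i j k) = taylor_coef F i j k.
  have [u Fu _] := conj_taylor_coef i j k FF'.
  by rewrite /P Fu valKd.
exists P => // i j k; rewrite PE -(taylor_coef_swap _ _ _ _ FF').
apply: conj_scalar_inj (conj_taylor_coef i k j FF').
by rewrite -PE; exists (P i k j).
Qed.

(** * The action of tau on sqrt 5 and on the golden ratio *)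

(** The image of sqrt 5 is a square root of 5; were it sqrt 5 itself, tau would
    fix every a + b sqrt 5 with a and b rational, that is, everything. *)
Lemma conj_sqrt5 : ~ (forall u, tau u = u) ->
  conj_scalar (Num.sqrt 5) (- Num.sqrt 5).
Proof.
move=> tau_neq; have s5 : Num.sqrt 5 \in @in_Qsqrt5 R.
  by apply/asboolP; exists 0, 1; rewrite rmorph0 rmorph1 add0r mul1r.
pose s := MkQsqrt5 s5; exists s => //.
have ss : s ^+ 2 = 5%:R.
  by apply: val_inj; rewrite rmorphXn rmorph_nat /= sqr_sqrtr.
have /eqP : tau s ^+ 2 = s ^+ 2 by rewrite -rmorphXn ss rmorph_nat.
rewrite eqf_sqr => /orP[/eqP tau_s|/eqP -> //]; exfalso; apply: tau_neq => u.
have /asboolP[a [b uE]] := valP u.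
have -> : u = ratr a + ratr b * s.
  by apply: val_inj; rewrite rmorphD (rmorphM _ (ratr b)) !fmorph_rat.
by rewrite rmorphD (rmorphM _ (ratr b)) !fmorph_rat tau_s.
Qed.

Lemma golden_gt0 : 0 < golden R.
Proof. by rewrite divr_gt0 // addr_gt0 // sqrtr_gt0. Qed.

(** - phi^-1 is the other root (1 - sqrt 5) / 2 of the polynomial X^2 - X - 1 of
    which phi is a root. *)
Lemma conj_golden : ~ (forall u, tau u = u) ->
  conj_scalar (golden R) (- (golden R)^-1).
Proof.
move=> /conj_sqrt5 s5; have g0 : golden R != 0 by rewrite gt_eqF ?golden_gt0.
have -> : - (golden R)^-1 = (1 + - Num.sqrt 5) / 2.
  have s5E : (Num.sqrt 5 : R) ^+ 2 = 5 by rewrite sqr_sqrtr.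
  apply: (mulfI g0); rewrite mulrN divff // /golden.
  by field: s5E.
apply: conj_scalarM; last exact/conj_scalarV/conj_scalar_nat.
by apply: conj_scalarD => //; exact: (conj_scalar_nat 1).
Qed.

End GaloisConjugation.

(** * The four symmetries *)

(** These tactics follow the syntax of a formula and build its conjugate, which
    is left as an existential variable in the goal.  Constant subterms are tried
    first, since only scalars may be inverted; the conjugates of sqrt 5 and phi
    are read off the context. *)
Ltac conj_scalar_tac := repeat first
  [ exact: conj_scalar_nat | eassumption
  | apply: conj_scalarM | apply: conj_scalarD | apply: conj_scalarN
  | apply: conj_scalarV | apply: conj_scalarX ].

Ltac conj_fun_tac := first
  [ apply: conj_cst; conj_scalar_tac
  | exact: (conj_coord _ X) | exact: (conj_coord _ Y)
  | exact: (conj_coord _ Z)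
  | apply: conjN; conj_fun_tac
  | apply: conjD; conj_fun_tac
  | apply: conjM; conj_fun_tac
  | apply: conj_sin; [conj_fun_tac | by rewrite /= ?(mulr0, mul0r)..]
  | apply: conj_cos; [conj_fun_tac | by rewrite /= ?(mulr0, mul0r)..] ].

Section GoldenFunctions.
Variables (R : realType) (tau : {rmorphism Qsqrt5 R -> Qsqrt5 R}).
Hypothesis tau_nontrivial : ~ (forall u, tau u = u).

Let conj_s5 := conj_sqrt5 tau_nontrivial.
Let conj_phi := conj_golden tau_nontrivial.

Let phi_neq0 : golden R != 0.
Proof. by rewrite gt_eqF // golden_gt0. Qed.

(** The substitution of - phi^-1 for phi in the arguments of sin and cos
    exchanges the two forms of frequency that occur in the formulas. *)
Lemma conj_frequency (t : R) :
  (- (golden R)^-1 * t / 2 = - (t / (2 * golden R))) *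
  (t / (2 * - (golden R)^-1) = - (golden R * t / 2)).
Proof. by split; field. Qed.

Lemma conj_fun_ext F F' G : conj_fun tau F F' ->
  (forall x y z, F' x y z = G x y z) -> conj_fun tau F G.
Proof. by move=> FF' /funext3 <-. Qed.

Lemma conj_Vx : conj_fun tau (@Vx R) (fun x y z => 1 * Vx x z y).
Proof.
apply: conj_fun_ext; first by rewrite /Vx; conj_fun_tac.
move=> x y z /=; rewrite /Vx !conj_frequency !sinN !cosN.
by field.
Qed.

Lemma conj_Wx : conj_fun tau (@Wx R) (fun x y z => -1 * Wx x z y).
Proof.
apply: conj_fun_ext; first by rewrite /Wx; conj_fun_tac.
move=> x y z /=; rewrite /Wx !conj_frequency !sinN !cosN.
by field.
Qed.

Lemma conj_V0x : conj_fun tau (@V0x R) (fun x y z => 1 * V0x x z y).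
Proof.
apply: conj_fun_ext; first by rewrite /V0x; conj_fun_tac.
move=> x y z /=; rewrite /V0x !conj_frequency !sinN !cosN.
by field.
Qed.

(** By definition V0z (x, y, z) = V0x (z, x, y), with conjugate V0x (z, y, x),
    which is V0y (x, z, y); in the same way V0z (x, z, y) is the conjugate of
    V0y (x, y, z).  The two sides of the final identity thus differ only by the
    order of two terms. *)
Lemma conj_W0x : conj_fun tau (@W0x R) (fun x y z => -1 * W0x x z y).
Proof.
have V0 : conj_fun tau (@V0x R) (fun x y z => V0x x z y).
  by apply: conj_fun_ext conj_V0x _ => x y z; rewrite mul1r.
have V0z := conj_rot V0; have V0y := conj_rot V0z.
apply: conj_fun_ext (conjD (conj_partial Y V0z) (conjN (conj_partial Z V0y))) _.
by move=> x y z; rewrite mulN1r opprB addrC.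
Qed.

End GoldenFunctions.

Theorem mainTheorem3 (R : realType) (tau : {rmorphism Qsqrt5 R -> Qsqrt5 R})
    (tau_bij : bijective tau) (tau_nontrivial : ~ (forall u, tau u = u)) :
  exists V W V0 W0 : power_series3 (Qsqrt5 R),
    [/\ is_taylor_series (@Vx R) V, is_taylor_series (@Wx R) W,
        is_taylor_series (@V0x R) V0 & is_taylor_series (@W0x R) W0] /\
    [/\ forall i j k, twist_swap tau V i j k = V i j k,
        forall i j k, twist_swap tau W i j k = - W i j k,
        forall i j k, twist_swap tau V0 i j k = V0 i j k
      & forall i j k, twist_swap tau W0 i j k = - W0 i j k].
Proof.
have [V VT Vtau] := conj_twist_swap (conj_Vx tau_nontrivial).
have [W WT Wtau] := conj_twist_swap (conj_Wx tau_nontrivial).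
have [V0 V0T V0tau] := conj_twist_swap (conj_V0x tau_nontrivial).
have [W0 W0T W0tau] := conj_twist_swap (conj_W0x tau_nontrivial).
exists V, W, V0, W0; do 2 split=> //; move=> i j k; apply: val_inj.
- by rewrite Vtau mul1r.
- by rewrite Wtau mulN1r rmorphN.
- by rewrite V0tau mul1r.
- by rewrite W0tau mulN1r rmorphN.
Qed.
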